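(* Let $\varepsilon\in(0,1/24)$ and let $p=p(n)$ satisfy $n^{5/8+\varepsilon}\le np\ll n^{2/3}$. Let $k=\lceil 15p^{-2}(n^{-1}\log n)^{1/2}\rceil$ and $k_*=\frac12\sqrt{\frac{\log(1/(np^3))}{2np^3}}$ (so that $k_*\ll 2k$), and let $(Z_\ell)_{\ell=1}^{2k}$ be independent random variables with $Z_\ell\in\mathrm{Bin}(z_\ell,p)$, where $$z_\ell=n-(\ell-1)np+\tfrac12(\ell-1)(\ell-2)np^2 .$$ Let $Z^{(1)}=\max\{Z_\ell:\ell\in[2k]\}$, $Z^{(2)}=\max\{Z_\ell:\ell\in[2k],\,Z_\ell<Z^{(1)}\}$, $Z^{(1)}_*=\max\{Z_\ell:1\le\ell\le k_*\}$ and $Z^{(2)}_*=\max\{Z_\ell:\ell\in[k_*],\,Z_\ell<Z^{(1)}_*\}$. Then a.a.s. $Z^{(1)}=Z^{(1)}_*$ and $Z^{(2)}=Z^{(2)}_*$.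
   Context: $[m]=\{1,\dots,m\}$; $f\ll g$ means $f=o(g)$ as $n\to\infty$; a.a.s. means with probability tending to $1$ as $n\to\infty$; $Z\in\mathrm{Bin}(z,p)$ means that $Z$ is binomially distributed with parameters $z$ and $p$. Quantities such as $z_\ell$ and $k_*$ that must be integers are understood to be rounded up or down. *)

(* Defs.v *)
From mathcomp Require Import all_boot all_order all_algebra.
From mathcomp Require Import all_classical all_reals all_analysis.
Import Order.TTheory GRing.Theory Num.Theory.
Import numFieldNormedType.Exports.

Set Implicit Arguments.
Unset Strict Implicit.
Unset Printing Implicit Defensive.

Local Open Scope classical_set_scope.
Local Open Scope ring_scope.

(* Mutual independence of the family (X i)_{i in I}: the product rule over
   every finite subfamily. *)
Definition mutually_independent (R : realType) (d d' : measure_display)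
    (T : measurableType d) (T' : measurableType d') (P : probability T R)
    (I : set nat) (X : nat -> {RV P >-> T'}) : Prop :=
  forall (s : seq nat) (A : nat -> set T'),
    uniq s -> [set` s] `<=` I -> (forall i, i \in s -> measurable (A i)) ->
    P (\bigcap_(i in [set` s]) (X i @^-1` A i)) =
    (\prod_(i <- s) P (X i @^-1` A i))%E.

Definition aas (R : realType) (d : nat -> measure_display)
    (T : forall n, measurableType (d n)) (P : forall n, probability (T n) R)
    (E : forall n, set (T n)) : Prop :=
  P n (E n) @[n --> \oo] --> 1%E.

Definition rounding (R : realType) (x : R) (m : nat) : Prop :=
  m%:Z = Num.floor x \/ m%:Z = Num.ceil x.

Section Quantities.
Variables (R : realType) (p : nat -> R).

(* The argument of the ceiling is nonnegative, so the absolute value only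
   casts from int to nat. *)
Definition k_ (n : nat) : nat :=
  `|Num.ceil (15 * p n ^- 2 * Num.sqrt (n%:R^-1 * ln n%:R))|%N.

Definition kstar_real (n : nat) : R :=
  2^-1 * Num.sqrt (ln (1 / (n%:R * p n ^+ 3)) / (2 * n%:R * p n ^+ 3)).

(* l ranges over 1, ..., 2k; the subtractions are taken in R, not in nat. *)
Definition z_real (n l : nat) : R :=
  n%:R - (l%:R - 1) * (n%:R * p n)
  + 2^-1 * (l%:R - 1) * (l%:R - 2) * (n%:R * p n ^+ 2).

End Quantities.

Definition max1 (m : nat) (a : nat -> nat) : nat :=
  \max_(1 <= l < m.+1) a l.

(* Largest value strictly below the maximum; it is 0 when a is constant on
   [1, m], which in the theorem happens with probability tending to 0. *)
Definition max2 (m : nat) (a : nat -> nat) : nat :=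
  \max_(1 <= l < m.+1 | (a l < max1 m a)%N) a l.

(* Main.v *)
(* With L = log(1/(n p^3)), s = sqrt L and r = sqrt(np), the mean of Z_l is close
   to np - (l - 1) n p^2, so it drops by p r = exp(-L/2) standard deviations at
   each step, and k_* steps make it drop by s / sqrt 8 standard deviations. Take
   the level b = np + (2/3) s r.
   - Each of the first 1/(p r) = exp(L/2) variables exceeds b with probability at
     least exp(-(0.45 + o(1)) L), even when it is asked to land in one of two
     disjoint windows of width O(r) just above b. By independence both windows
     are hit, so two distinct values above b are taken before k_*.
   - By Chernoff's bound the variables after k_* exceed b with total probability
     at most exp(L/2 - (2/3 + 0.35)^2 L / 2), up to a constant, which tends to 0.
   On these events the two largest values are taken before k_*. *)
Require Import Defs.
From mathcomp Require Import all_boot all_order all_algebra.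
From mathcomp Require Import all_classical all_reals all_analysis.
From mathcomp Require Import unstable ring lra.
Import Order.TTheory GRing.Theory Num.Theory.
Import numFieldNormedType.Exports.

Local Open Scope classical_set_scope.
Local Open Scope ring_scope.

(** * Expectations and tails of binomial distributions *)

(** A finite real sum instead of an integral, so that exact moments follow by induction on [z];
    [binomial_prob_Ebin] links it to the measure. *)
Definition Ebin (R : realType) (z : nat) (p : R) (f : nat -> R) : R :=
  \sum_(j < z.+1) binomial_pmf z p j * f j.

Section binomial_expectation.
Context {R : realType}.
Implicit Types (z : nat) (p : R) (f g : nat -> R).

Lemma Ebin0 p f : Ebin R 0 p f = f 0%N.
Proof. by rewrite /Ebin big_ord1 /binomial_pmf bin0 !expr0 mulr1 mulr1n mul1r. Qed.

(** Conditioning on one trial; on the coefficients this is Pascal's rule. *)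
Lemma EbinS z p f :
  Ebin R z.+1 p f = p * Ebin R z p (f \o succn) + (1 - p) * Ebin R z p f.
Proof.
rewrite /Ebin big_ord_recl /= !mulr_sumr.
rewrite [in X in _ = _ + X]big_ord_recl /=.
under eq_bigr => i _.
  have -> : binomial_pmf z.+1 p (bump 0 i) * f (bump 0 i) =
     p * (binomial_pmf z p i * f i.+1) +
     (p ^+ i.+1 * (1 - p) ^+ (z - i) *+ 'C(z, i.+1)) * f i.+1.
    rewrite /binomial_pmf /bump /= add1n binS mulrnDr subSS /onem exprS.
    ring.
  over.
rewrite big_split /= addrCA; congr (_ + _); congr (_ + _).
  by rewrite /binomial_pmf !bin0 !subn0 /onem exprS; rewrite !mulr1n; ring.
rewrite big_ord_recr /= bin_small // mulr0n mul0r addr0.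
apply: eq_bigr => i _.
rewrite /binomial_pmf /onem /bump /= add1n -[in LHS](@subnSK i z) ?ltn_ord//.
by rewrite (exprS (1 - p)); ring.
Qed.

Lemma Ebin_cst z p (a : R) : Ebin R z p (fun=> a) = a.
Proof. by elim: z => [|z IH]; rewrite ?Ebin0// EbinS /comp IH; ring. Qed.

Lemma Ebin_exp z p u : Ebin R z p (fun j => (1 + u) ^+ j) = (1 + p * u) ^+ z.
Proof.
have EbinZ z' f c : Ebin R z' p (fun j => c * f j) = c * Ebin R z' p f.
  by rewrite /Ebin mulr_sumr; apply: eq_bigr => i _; ring.
elim: z => [|z IH]; first by rewrite Ebin0.
rewrite EbinS IH /comp; under eq_fun => j do rewrite exprS.
by rewrite EbinZ IH exprS; ring.
Qed.

(** The centre [a] is arbitrary because, in the induction, a success moves it to [a - 1]. *)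
Lemma Ebin_sqr z p a :
  Ebin R z p (fun j => (j%:R - a) ^+ 2) =
  z%:R * p * (1 - p) + (z%:R * p - a) ^+ 2.
Proof.
elim: z a => [|z IH] a; first by rewrite Ebin0; ring.
rewrite EbinS IH.
rewrite (_ : _ \o _ = fun j => (j%:R - (a - 1)) ^+ 2); last first.
  by apply/funext => j /=; rewrite -natr1; congr (_ ^+ 2); ring.
by rewrite IH -natr1; ring.
Qed.

Lemma ler_Ebin z p f g : 0 <= p <= 1 ->
  (forall j, (j <= z)%N -> f j <= g j) -> Ebin R z p f <= Ebin R z p g.
Proof.
move=> p01 fg; apply: ler_sum => i _.
by apply: ler_wpM2l; [exact: binomial_pmf_ge0 | apply: fg; rewrite -ltnS].
Qed.

Lemma binomial_prob_Ebin z p (A : set nat) : 0 <= p <= 1 ->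
  binomial_prob z p A = (Ebin R z p (fun j => (j \in A)%:R))%:E.
Proof.
move=> /andP[p0 p1]; rewrite (@binomial_probE R z p p0 p1).
rewrite /Ebin -sumEFin; apply: eq_bigr => i _.
by rewrite diracE -EFinM.
Qed.

(** The quotient [f] of the two sides equals 1 at 0, and its derivative is [x ^ 2] times a positive
    factor. *)
Lemma expR_sub_sqr_le (u : R) : 0 <= u -> expR (u - u ^+ 2 / 2) <= 1 + u.
Proof.
move=> u0.
pose f (x : R) : R := expR (- (x - x ^+ 2 / 2)) * (1 + x).
pose df (x : R) : R := expR (- (x - x ^+ 2 / 2)) * x ^+ 2.
have fd (x : R) : is_derive x 1 f (df x).
  rewrite /f /df; apply: is_derive_eq.
  by rewrite /GRing.scale /=; field.
suff : f 0 <= f u.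
  rewrite /f expr0n /= mul0r subrr oppr0 expR0 addr0 mulr1 expRN.
  by rewrite mulrC ler_pdivlMr ?expR_gt0// mul1r.
have fc : {within `[0, u], continuous f}.
  apply: derivable_within_continuous => y _.
  exact: (@ex_derive _ _ _ _ _ _ _ (fd y)).
have [c _ fE] := MVT_segment u0 (fun x _ => fd x) fc.
rewrite -subr_ge0 fE subr0; apply: mulr_ge0 => //.
by apply: mulr_ge0; [exact: expR_ge0 | exact: sqr_ge0].
Qed.

(** Markov's inequality for [(1 + u) ^ j], whose mean [(1 + p u) ^ z] is at most [exp (z p u)]. The
    bound [u <= 2] keeps [h] nonnegative, so the weight is at least 1 wherever [b <= j]. *)
Lemma Ebin_upper_tail z p (u b : R) : 0 <= p <= 1 -> 0 <= u <= 2 ->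
  Ebin R z p (fun j => (b <= j%:R)%R%:R) <=
  expR (z%:R * p * u - b * (u - u ^+ 2 / 2)).
Proof.
move=> p01 /andP[u0 u2]; set h := u - u ^+ 2 / 2.
have h0 : 0 <= h by rewrite /h; nra.
apply: (@le_trans _ _ (Ebin R z p (fun j => expR (- (b * h)) * (1 + u) ^+ j))).
  apply: ler_Ebin => // j _; case: (leP b) => [bj|_] /=; last first.
    by rewrite mulr_ge0 ?expR_ge0// exprn_ge0// addr_ge0.
  apply: (@le_trans _ _ (expR (- (b * h)) * expR (h * j%:R))).
    by rewrite -expRD -[X in X <= _]expR0 ler_expR; nra.
  rewrite ler_wpM2l ?expR_ge0// expRM_natr lerXn2r ?nnegrE ?expR_ge0//.
    by rewrite addr_ge0.
  exact: expR_sub_sqr_le.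
have -> : Ebin R z p (fun j => expR (- (b * h)) * (1 + u) ^+ j) =
    expR (- (b * h)) * (1 + p * u) ^+ z.
  by rewrite -Ebin_exp /Ebin mulr_sumr; apply: eq_bigr => i _; ring.
rewrite [X in _ <= expR X]addrC expRD ler_wpM2l ?expR_ge0// -mulrA expRM_natl.
case/andP: p01 => p0 p1.
by rewrite lerXn2r ?nnegrE ?expR_ge0 ?expR_ge1Dx// addr_ge0// mulr_ge0.
Qed.

(* Exponential tilting: under the success probability [p (1 + u) = w ^ 2 / z]
   the mean is [w ^ 2], so Chebyshev gives the window mass at least [3 / 4],
   and the likelihood ratio is bounded below on the window. *)
Lemma Ebin_window z p (u w : R) : 0 < p <= 1 -> 0 <= u -> 0 < w ->
  z%:R * (p * (1 + u)) = w ^+ 2 -> p * (1 + u) <= 1 ->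
  3 / 4 * expR (- (u * (w ^+ 2 - z%:R * p + 2 * w + p * (w ^+ 2 + 2 * w)))) <=
  Ebin R z p (fun j => (`|j%:R - w ^+ 2| <= 2 * w)%R%:R).
Proof.
move=> /andP[p0 p1] u0 w0 zw pu1.
set K := u * _; set p' := p * (1 + u).
have p'0 : 0 <= p' by rewrite /p' mulr_ge0 ?(ltW p0)// addr_ge0.
have p'01 : 0 <= p' <= 1 by rewrite p'0.
(* The indicator dominates the parabola [1 - (j - w ^ 2) ^ 2 / (4 w ^ 2)], and the variance
   [w ^ 2 (1 - p')] is at most [w ^ 2]. *)
have cheb : 3 / 4 <= Ebin R z p' (fun j => (`|j%:R - w ^+ 2| <= 2 * w)%R%:R).
  apply: (@le_trans _ _
      (Ebin R z p' (fun j => 1 - (4 * w ^+ 2)^-1 * (j%:R - w ^+ 2) ^+ 2))).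
    have -> : Ebin R z p' (fun j => 1 - (4 * w ^+ 2)^-1 * (j%:R - w ^+ 2) ^+ 2)
        = 1 - (4 * w ^+ 2)^-1 * Ebin R z p' (fun j => (j%:R - w ^+ 2) ^+ 2).
      rewrite -[X in _ = X - _](Ebin_cst z p' 1) /Ebin mulr_sumr -sumrB.
      by apply: eq_bigr => i _; ring.
    rewrite Ebin_sqr zw subrr expr0n addr0 /=.
    have -> : (4 * w ^+ 2)^-1 * (w ^+ 2 * (1 - p')) = (1 - p') / 4.
      by field; rewrite gt_eqF.
    lra.
  apply: ler_Ebin => // j _; case: (leP `|_|) => [_|] /=.
    by rewrite gerBl mulr_ge0 ?sqr_ge0// invr_ge0 mulr_ge0 ?sqr_ge0.
  move=> /ltW jw; rewrite subr_le0 mulrC ler_pdivlMr; last first.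
    by rewrite mulr_gt0// exprn_gt0.
  rewrite mul1r -[leRHS]real_normK ?num_real//.
  by rewrite (_ : 4 * w ^+ 2 = (2 * w) ^+ 2); [rewrite lerXn2r// nnegrE; lra|ring].
apply: (@le_trans _ _
   (expR (- K) * Ebin R z p' (fun j => (`|j%:R - w ^+ 2| <= 2 * w)%R%:R))).
  by rewrite mulrC ler_wpM2l ?expR_ge0.
rewrite /Ebin mulr_sumr; apply: ler_sum => -[j /=]; rewrite ltnS => jz _.
case: (leP `|_|) => [jw|_] /=; last by rewrite !mulr0.
rewrite !mulr1 /binomial_pmf mulrnAr ler_wMn2r//.
(* The likelihood ratio is bounded trial by trial: a success contributes at least [exp (- u)] and a
   failure at least [exp (p u)]. On the window [j <= w ^ 2 + 2 w], so the total exponent is at least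
   [- K]. *)
have e1 : p' * expR (- u) <= p.
  rewrite expRN ler_pdivrMr ?expR_gt0// /p' ler_wpM2l ?(ltW p0)//.
  exact: expR_ge1Dx.
have e2 : (1 - p') * expR (p * u) <= 1 - p.
  rewrite -[expR _]invrK -expRN ler_pdivrMr ?expR_gt0//.
  have : 1 - p * u <= expR (- (p * u)) by apply: expR_ge1Dx.
  by rewrite /p'; nra.
have e3 : - K <= - u * j%:R + p * u * (z - j)%N%:R.
  rewrite natrB// /K; move: jw; rewrite ler_norml => /andP[_ jw].
  have -> : - u * j%:R + p * u * (z%:R - j%:R) =
    - (u * (j%:R + p * j%:R - z%:R * p)) by ring.
  rewrite lerN2 ler_wpM2l//.
  have : p * j%:R <= p * (w ^+ 2 + 2 * w) by rewrite ler_wpM2l ?(ltW p0)//; lra.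
  lra.
apply: (@le_trans _ _ ((p' * expR (- u)) ^+ j *
    ((1 - p') * expR (p * u)) ^+ (z - j))).
  rewrite [(p' * _) ^+ _]exprMn [(_ * expR (p * u)) ^+ _]exprMn.
  rewrite -!expRM_natr mulrACA [leRHS]mulrC -expRD.
  rewrite ler_wpM2r ?ler_expR//.
  by apply: mulr_ge0; rewrite exprn_ge0// subr_ge0.
apply: ler_pM.
- by rewrite exprn_ge0// mulr_ge0 ?expR_ge0.
- by rewrite exprn_ge0// mulr_ge0 ?expR_ge0// subr_ge0.
- by rewrite lerXn2r ?nnegrE ?(ltW p0)// mulr_ge0 ?expR_ge0.
- by rewrite lerXn2r ?nnegrE ?subr_ge0// mulr_ge0 ?expR_ge0// subr_ge0.
Qed.

End binomial_expectation.

(** * Truncating the two largest values *)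

(** Since [a i < a j], the value [a i] is a candidate for the second maximum. Hence both maxima over
    [[1, k]] are at least [a i], and no later value can change them. *)
Lemma max1_max2_truncate (N k : nat) (a : nat -> nat) (i j : nat) :
  (k <= N)%N -> (1 <= i <= k)%N -> (1 <= j <= k)%N -> (a i < a j)%N ->
  (forall l, (k < l <= N)%N -> (a l < a i)%N) ->
  max1 N a = max1 k a /\ max2 N a = max2 k a.
Proof.
move=> kN ik jk aij tail.
have max1E : max1 N a = max1 k a.
  rewrite /max1 (big_cat_nat _ (n := k.+1))//=.
  apply/maxn_idPl; rewrite big_nat_cond; apply/bigmax_leqP_seq => l _.
  rewrite andbT ltnS => /tail al.
  apply: (@leq_trans (a i)); first exact: ltnW.
  by apply: (@leq_bigmax_seq _ _ xpredT a) => //; rewrite mem_index_iota ltnS.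
split=> //; rewrite /max2 max1E (big_cat_nat _ (n := k.+1))//=.
apply/maxn_idPl; rewrite big_nat_cond; apply/bigmax_leqP_seq => l _.
rewrite ltnS => /andP[/tail al _].
apply: (@leq_trans (a i)); first exact: ltnW.
apply: (@leq_bigmax_seq _ _ (fun l => (a l < max1 k a)%N) a).
  by rewrite mem_index_iota ltnS.
apply: (leq_trans aij).
by apply: (@leq_bigmax_seq _ _ xpredT a) => //; rewrite mem_index_iota ltnS.
Qed.

Lemma eq_max1 N (a b : nat -> nat) :
  (forall l, (l <= N)%N -> a l = b l) -> max1 N a = max1 N b.
Proof. by move=> ab; apply: eq_big_nat => l /andP[_]; rewrite ltnS => /ab. Qed.

Lemma eq_max2 N (a b : nat -> nat) :
  (forall l, (l <= N)%N -> a l = b l) -> max2 N a = max2 N b.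
Proof.
move=> ab; rewrite /max2 -(eq_max1 N a b ab) big_nat_cond [RHS]big_nat_cond.
apply: eq_big => [l|l /andP[/andP[_]]]; last by rewrite ltnS => /ab.
by case: (boolP (1 <= l < N.+1)%N) => //= /andP[_]; rewrite ltnS => /ab ->.
Qed.

(** Induction on the number [M] of coordinates not frozen at 0: the event is split over the
    countably many values of the last free coordinate. *)
Lemma measurable_finite_family d (T : measurableType d) (X : nat -> T -> nat)
    (N : nat) (Q : (nat -> nat) -> Prop) :
  (forall l, measurable_fun setT (X l)) ->
  (forall a b, (forall l, (l <= N)%N -> a l = b l) -> Q a -> Q b) ->
  measurable [set w | Q (X ^~ w)].
Proof.
move=> mX QN.
suff H M : forall Q' : (nat -> nat) -> Prop,
    measurable [set w | Q' (fun l => if (l < M)%N then X l w else 0%N)].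
  rewrite (_ : mkset _ =
      [set w | Q (fun l => if (l < N.+1)%N then X l w else 0%N)])//.
  by apply/seteqP; split=> w /=; apply: QN => l; rewrite ltnS => ->.
elim: M => [|M IH] Q'.
  have [q|q] := pselect (Q' (fun=> 0%N)).
    by rewrite (_ : mkset _ = setT) //; apply/seteqP; split.
  by rewrite (_ : mkset _ = set0) //; apply/seteqP; split.
rewrite (_ : mkset _ = \bigcup_j (X M @^-1` [set j] `&`
    [set w | Q' (fun l => if l == M then j else
                          if (l < M)%N then X l w else 0%N)])).
  apply: bigcupT_measurable => j; apply: measurableI.
    by rewrite -[X in measurable X]setTI; apply: mX.
  exact: (IH (fun a => Q' (fun l => if l == M then j else a l))).
have E w j : X M w = j ->
    (fun l => if (l < M.+1)%N then X l w else 0%N) =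
    (fun l => if l == M then j else if (l < M)%N then X l w else 0%N).
  by move=> <-; apply/funext => l; rewrite ltnS leq_eqVlt; case: eqP => [->|].
apply/seteqP; split=> w /=.
  by move=> q; exists (X M w) => //; split => //=; rewrite -(E w).
by move=> [j _ [/= /E ->]].
Qed.

Section windows.
Context {R : realType} d (T : measurableType d) (P : probability T R).
Variable X : nat -> {RV P >-> nat}.

Let mpre l (A : set nat) : measurable (X l @^-1` A).
Proof. exact: measurable_funPTI. Qed.

Lemma probability_bigsetU_le (I : Type) (s : seq I) (F : I -> set T) :
  (forall i, measurable (F i)) ->
  (P (\big[setU/set0]_(i <- s) F i) <= \sum_(i <- s) P (F i))%E.
Proof.
move=> mF; elim: s => [|i s IH]; first by rewrite !big_nil measure0.
rewrite !big_cons; apply: le_trans; first apply: measureU2 => //.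
  exact: bigsetU_measurable.
by rewrite leeD2l.
Qed.

(** Independence gives a product of [m] factors, each at most [1 - q <= exp (- q)]. *)
Lemma all_miss_le (I : set nat) (m : nat) (W : set nat) (q : R) :
  mutually_independent I X -> (forall l, (1 <= l <= m)%N -> I l) ->
  (forall l, (1 <= l <= m)%N -> (q%:E <= P (X l @^-1` W))%E) ->
  (P (\bigcap_(l in [set` iota 1 m]) (X l @^-1` ~` W)) <=
   (expR (- (m%:R * q)))%:E)%E.
Proof.
move=> indep mI qW; rewrite (indep _ (fun=> ~` W)) ?iota_uniq//; last first.
  by move=> l /=; rewrite mem_iota add1n ltnS => /mI.
have prod_le (s : seq nat) (f : nat -> \bar R) (c : R) :
    (forall l, l \in s -> (0 <= f l <= c%:E)%E) ->
    ((0 <= \prod_(l <- s) f l)%E && (\prod_(l <- s) f l <= (c ^+ size s)%:E)%E).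
  elim: s => [|l s IH] fc.
    by rewrite big_nil expr0 lee01 lexx.
  have /andP[f0 fle] := fc l (mem_head _ _).
  have /andP[p0 ple] : ((0 <= \prod_(l <- s) f l)%E &&
      (\prod_(l <- s) f l <= (c ^+ size s)%:E)%E).
    by apply: IH => k ks; apply: fc; rewrite in_cons ks orbT.
  by rewrite big_cons /= exprS EFinM mule_ge0//= lee_pmul.
have miss l : l \in iota 1 m ->
    (0 <= P (X l @^-1` ~` W) <= (expR (- q))%:E)%E.
  rewrite mem_iota add1n ltnS => /qW qWl.
  rewrite measure_ge0 andTb preimage_setC probability_setC; last exact: mpre.
  apply: (@le_trans _ _ (1 - q%:E)%E); first by rewrite leeD2l// leeN2.
  by rewrite -EFinB lee_fin expR_ge1Dx.
have /andP[_] := prod_le _ _ _ miss.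
by rewrite size_iota -expRM_natl mulrN.
Qed.

Lemma measurable_max1_max2_eq (N k : nat) :
  measurable [set w | max1 N (X ^~ w) = max1 k (X ^~ w) /\
                      max2 N (X ^~ w) = max2 k (X ^~ w)].
Proof.
apply: (measurable_finite_family _ T (fun l => X l) (N + k)
  (fun a => max1 N a = max1 k a /\ max2 N a = max2 k a)) => [l|a b ab].
  exact: measurable_funP.
have abN l : (l <= N)%N -> a l = b l by move=> lN; apply/ab/(leq_trans lN)/leq_addr.
have abk l : (l <= k)%N -> a l = b l by move=> lk; apply/ab/(leq_trans lk)/leq_addl.
by rewrite (eq_max1 N a b)// (eq_max2 N a b)// (eq_max1 k a b)// (eq_max2 k a b).
Qed.

(* If two increasing windows are both hit before [k] while the indices after [k]
   stay below both, the two largest values are attained before [k]. *)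
Lemma max1_max2_truncate_prob (N k m : nat) (W1 W2 S : set nat) (q t : R) :
  mutually_independent [set l | (1 <= l <= N)%N] X -> (m <= k <= N)%N ->
  (forall i j, W1 i -> W2 j -> (i < j)%N) ->
  (forall i j, W1 i -> ~ S j -> (j < i)%N) ->
  (forall l, (1 <= l <= m)%N -> (q%:E <= P (X l @^-1` W1))%E) ->
  (forall l, (1 <= l <= m)%N -> (q%:E <= P (X l @^-1` W2))%E) ->
  (\sum_(l <- index_iota k.+1 N.+1) P (X l @^-1` S) <= t%:E)%E ->
  ((1 - t - 2 * expR (- (m%:R * q)))%:E <=
   P [set w | max1 N (X ^~ w) = max1 k (X ^~ w) /\
              max2 N (X ^~ w) = max2 k (X ^~ w)])%E.
Proof.
move=> indep /andP[mk kN] W12 W1S qW1 qW2 St.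
set E := mkset _; have mE : measurable E by exact: measurable_max1_max2_eq.
pose F W := \bigcap_(l in [set` iota 1 m]) (X l @^-1` ~` W).
have mF W : measurable (F W).
  by apply: bigcap_measurableType => l _; exact: mpre.
pose H := \big[setU/set0]_(l <- index_iota k.+1 N.+1) (X l @^-1` S).
have mH : measurable H by apply: bigsetU_measurable.
(* The deterministic core: if both windows are hit by the first [m] indices and no index after [k]
   lands in [S], then [max1_max2_truncate] applies. *)
have EC : ~` E `<=` (F W1 `|` F W2) `|` H.
  move=> w; apply: contra_notP => /not_orP[/not_orP[nF1 nF2] nH].
  have hit W : ~ F W w -> exists2 l, (1 <= l <= k)%N & W (X l w).
    move=> /existsNP[l /not_implyP[/= lm /contrapT Wl]]; exists l => //.
    move: lm; rewrite mem_iota add1n ltnS => /andP[-> lm].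
    exact: leq_trans mk.
  have [i ik W1i] := hit _ nF1; have [j jk W2j] := hit _ nF2.
  apply: (max1_max2_truncate N k (X ^~ w) i j) => //; first exact: W12.
  move=> l /andP[kl lN]; apply: W1S => // Sl; apply: nH.
  rewrite /H -bigcup_seq; exists l => //=.
  by rewrite mem_index_iota kl ltnS.
have PH : (P H <= t%:E)%E by apply: le_trans St; exact: probability_bigsetU_le.
have PF W : (forall l, (1 <= l <= m)%N -> (q%:E <= P (X l @^-1` W))%E) ->
    (P (F W) <= (expR (- (m%:R * q)))%:E)%E.
  move=> qW; apply: all_miss_le indep _ qW => l /andP[l0 lm] /=; rewrite l0 /=.
  exact: leq_trans (leq_trans lm mk) kN.
have PEC : (P (~` E) <= (t + 2 * expR (- (m%:R * q)))%:E)%E.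
  apply: (@le_trans _ _ (P ((F W1 `|` F W2) `|` H))).
    by apply: le_measure => //; rewrite inE; [exact: measurableC|
      apply: measurableU => //; exact: measurableU].
  apply: le_trans; first by apply: measureU2 => //; exact: measurableU.
  rewrite addrC EFinD leeD//.
  apply: le_trans; first by apply: measureU2.
  by rewrite mulr_natl mulr2n EFinD leeD// PF.
have -> : P E = (1 - P (~` E))%E by rewrite -probability_setC ?setCK//; exact: measurableC.
by rewrite -addrA -opprD EFinB leeD2l// leeN2.
Qed.
End windows.

(** * Tail and window estimates *)

(** From [y (1 + h) <= 1] and [h <= 1] one gets [1 - y >= h / 2]; the sum multiplied by [1 - y]
    telescopes. *)
Lemma geometric_tail_le (R : realType) (h : R) (k N : nat) : 0 < h <= 1 ->
  \sum_(k <= i < N) expR (- h) ^+ i <= expR (- h) ^+ k * (2 / h).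
Proof.
move=> /andP[h0 h1]; set y := expR (- h).
have y0 : 0 <= y by exact: expR_ge0.
have y1 : y * (1 + h) <= 1.
  by rewrite /y expRN mulrC ler_pdivrMr ?expR_gt0// mul1r expR_ge1Dx.
have yh : h / 2 <= 1 - y by nra.
have sumE : (1 - y) * \sum_(k <= i < N) y ^+ i <= y ^+ k.
  have [Nk|/ltnW kN] := leqP N k; first by rewrite big_geq// mulr0 exprn_ge0.
  rewrite mulr_sumr (@telescope_sumr_eq _ _ _ (fun i => - y ^+ i))//; last first.
    by move=> i _; rewrite exprS; ring.
  by rewrite opprK gerDr oppr_le0 exprn_ge0.
rewrite mulrA ler_pdivlMr// mulrC.
have S0 : 0 <= \sum_(k <= i < N) y ^+ i by apply: sumr_ge0 => i _; exact: exprn_ge0.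
nra.
Qed.

(* Here [s ^ 2 = ln (1 / (n p ^ 3))] and [r ^ 2 = n p], [zr l] is the exact
   value of z_l and [N = 2k]. In the level [b = r ^ 2 + c s r] below, [c = 2 / 3]
   is a choice in the interval given by [c ^ 2 < 1 / 2], which makes the windows
   hit (the likelihood ratio in [Ebin_window] is not sharp and costs a factor 2
   in the exponent), and [c + 1 / sqrt 8 > 1], which makes the tail vanish. *)
Section estimates.
Context {R : realType} (n p r s : R) (N : nat) (z : nat -> nat).

Let E : R := expR (s ^+ 2 / 2).
Let zr (l : nat) : R := n - (l%:R - 1) * (n * p)
  + 2^-1 * (l%:R - 1) * (l%:R - 2) * (n * p ^+ 2).

Hypothesis s_big : 400 <= s.
Hypothesis p_gt0 : 0 < p.
Hypothesis r_gt0 : 0 < r.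
Hypothesis npE : n * p = r ^+ 2.
Hypothesis prE : p * r * E = 1.
Hypothesis Er : E ^+ 5 <= r.
Hypothesis Np : N%:R * p <= 1 / 100.
Hypothesis z_close : forall l, (1 <= l <= N)%N -> zr l - 1 <= (z l)%:R <= zr l + 1.

Let E_ge : s ^+ 2 / 2 + 1 <= E.
Proof. by rewrite addrC expR_ge1Dx. Qed.

Let E_gt0 : 0 < E. Proof. exact: expR_gt0. Qed.

Let E1 : 1 <= E. Proof. by apply: le_trans E_ge; nra. Qed.

(** [E ^ 2] is at least [s ^ 4 / 4], and [s >= 400] turns this into [100 s ^ 3]. This absorbs the
    cubic error of Chernoff's bound. *)
Let r_ge : 100 * s ^+ 3 <= r.
Proof.
have s1 := s_big; apply: le_trans Er.
have E2 : s ^+ 3 * 100 <= E ^+ 2.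
  apply: (@le_trans _ _ ((s ^+ 2 / 2) ^+ 2)); last first.
    rewrite lerXn2r ?nnegrE ?(ltW E_gt0) ?divr_ge0 ?sqr_ge0//.
    by have := E_ge; lra.
  rewrite (_ : _ ^+ 2 = s ^+ 3 * (s / 4)); last by field.
  by rewrite ler_wpM2l ?exprn_ge0//; lra.
have : E ^+ 2 <= E ^+ 5 by rewrite ler_weXn2l.
have : 0 <= s ^+ 3 by rewrite exprn_ge0//; lra.
lra.
Qed.

Let r_ges : 400 * s <= r.
Proof.
have s1 := s_big; apply: le_trans r_ge.
rewrite (_ : 100 * s ^+ 3 = 100 * s ^+ 2 * s); last by ring.
by rewrite ler_wpM2r; nra.
Qed.

Let pr1 : p * r <= 1.
Proof. by rewrite -prE ler_peMr// mulr_ge0 ?ltW. Qed.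

Let p_le : p <= 1 / 100.
Proof. by have := pr1; have := r_ges; have := s_big; have := p_gt0; nra. Qed.

(** With [x = l - 1], the quadratic term of the mean is at most [x p / 2 <= 1 / 200] of the linear
    drop, which leaves the factor [199 / 200]. The final [p] comes from rounding. *)
Lemma mean_upper l : (1 <= l <= N)%N ->
  (z l)%:R * p <= r ^+ 2 - 199 / 200 * l.-1%:R * (p * r ^+ 2) + p.
Proof.
have p0 := p_gt0; move=> lN; have /andP[_ zl] := z_close l lN; case/andP: lN => l1 lN.
have lp : l.-1%:R * p <= 1 / 100.
  apply: le_trans Np; rewrite ler_wpM2r ?(ltW p_gt0)// ler_nat.
  exact: leq_trans (leq_pred l) lN.
have lE : l%:R = l.-1%:R + 1 :> R by rewrite natr1 prednK.
have x0 : 0 <= l.-1%:R :> R by rewrite ler0n.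
move: zl; rewrite /zr lE; set x := l.-1%:R in lp x0 *.
rewrite -(ler_pM2r p_gt0) => zl; apply: (le_trans zl).
have -> : (n - (x + 1 - 1) * (n * p) + 2^-1 * (x + 1 - 1) * (x + 1 - 2) * (n * p ^+ 2) + 1) * p
  = (n * p) - x * ((n * p) * p) + 2^-1 * (x * (x - 1) * p) * (p * (n * p)) + p by field.
rewrite npE.
have h1 : 0 <= p * r ^+ 2 by rewrite mulr_ge0 ?sqr_ge0 ?ltW.
have h2 : x * (x - 1) * p <= x / 100 by nra.
have h3 : x * (x - 1) * p * (p * r ^+ 2) <= x / 100 * (p * r ^+ 2).
  by rewrite ler_wpM2r.
by lra.
Qed.

(** As [E = 1 / (p r)], up to index [E] the mean drops by at most [r], about one standard
    deviation. *)
Lemma mean_bounds l : (1 <= l <= N)%N -> l%:R <= E ->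
  r ^+ 2 - r - 1 <= (z l)%:R * p <= r ^+ 2 + 1.
Proof.
have p0 := p_gt0; have r0 := r_gt0; move=> lN lE; apply/andP; split; last first.
  apply: le_trans (mean_upper l lN) _.
  have : 0 <= 199 / 200 * l.-1%:R * (p * r ^+ 2).
    apply: mulr_ge0; last by rewrite mulr_ge0 ?sqr_ge0// ltW.
    by apply: mulr_ge0; [lra | exact: ler0n].
  by have := p_le; lra.
have /andP[zl _] := z_close l lN; case/andP: lN => l1 lN.
have x0 : 0 <= l.-1%:R :> R by rewrite ler0n.
have xx : l.-1%:R * l.-2%:R = l.-1%:R * (l.-1%:R - 1) :> R.
  by case: l.-1 => [|k] /=; rewrite ?mul0r// -natr1 addrK.
have xx0 : 0 <= l.-1%:R * (l.-1%:R - 1) :> R by rewrite -xx mulr_ge0 ?ler0n.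
move: lE zl; rewrite /zr (_ : l%:R = l.-1%:R + 1); last by rewrite natr1 prednK.
set x : R := l.-1%:R in x0 xx0 *; move=> xE.
rewrite -(ler_pM2r p_gt0) => zl; apply: le_trans zl.
have -> : (n - (x + 1 - 1) * (n * p) + 2^-1 * (x + 1 - 1) * (x + 1 - 2) * (n * p ^+ 2) - 1) * p
  = (n * p) - x * ((n * p) * p) + 2^-1 * (x * (x - 1)) * (p * p * (n * p)) - p by field.
rewrite npE.
have h1 : 0 <= 2^-1 * (x * (x - 1)) * (p * p * r ^+ 2).
  apply: mulr_ge0; first by rewrite mulr_ge0// invr_ge0.
  by rewrite mulr_ge0 ?sqr_ge0// mulr_ge0 ?ltW.
have h2 : x * (r ^+ 2 * p) <= r.
  have -> : x * (r ^+ 2 * p) = x * (p * r) * r by ring.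
  rewrite ler_piMl ?(ltW r_gt0)// -prE mulrC ler_wpM2l ?mulr_ge0 ?ltW//.
  lra.
by have := p_le; lra.
Qed.

Let b : R := r ^+ 2 + 2 / 3 * s * r.
(* The optimal Chernoff parameter at the index k_*, [2 / 3 + 0.35 = 61 / 60], is
   used at all indices after k_*, so that the bounds sum geometrically. *)
Let v : R := 61 / 60 * s.

(** Chernoff's bound with [u = v / r]: the terms [r v] cancel and a Gaussian exponent remains. The
    errors [p v / r] and [s v ^ 2 / (3 r)] add up to at most 1 by [r_ge]. The drop of the mean gives
    the geometric factor. *)
Lemma tail_one_le l : (1 <= l <= N)%N ->
  Ebin R (z l) p (fun j => (b <= j%:R)%R%:R) <=
  expR (v ^+ 2 / 2 - 2 / 3 * s * v + 1) *
  expR (- (199 / 200 * (p * r) * v)) ^+ l.-1.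
Proof.
have s1 := s_big; have r0 := r_gt0; have p0 := p_gt0.
move=> lN; have zp := mean_upper l lN.
have v0 : 0 < v by rewrite /v; lra.
have u0 : 0 <= v / r by rewrite divr_ge0 ?ltW.
have u2 : v / r <= 2 by rewrite ler_pdivrMr// /v; have := r_ges; lra.
have p01 : 0 <= p <= 1 by have := p_le; have := p_gt0; lra.
apply: le_trans (Ebin_upper_tail (z l) p (v / r) b p01 _) _; first by rewrite u0.
rewrite -expRM_natr -expRD ler_expR.
have h1 : (z l)%:R * p * (v / r) <=
    r * v - 199 / 200 * l.-1%:R * (p * r) * v + p * v / r.
  apply: le_trans (ler_wpM2r u0 zp) _; rewrite le_eqVlt; apply/orP; left.
  by apply/eqP; field; rewrite gt_eqF.
have h2 : b * (v / r - (v / r) ^+ 2 / 2) =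
    r * v - v ^+ 2 / 2 + 2 / 3 * s * v - 3^-1 * s * v ^+ 2 / r.
  by rewrite /b; field; rewrite gt_eqF.
have h3 : p * v / r + 3^-1 * s * v ^+ 2 / r <= 1.
  rewrite -mulrDl ler_pdivrMr// mul1r; apply: le_trans r_ge.
  have e1 : p * v <= v by rewrite ler_piMl ?(ltW v0)//; case/andP: p01.
  have e2 : s <= s ^+ 3 by rewrite exprS expr2; nra.
  have e3 : 3^-1 * s * v ^+ 2 = 3^-1 * (61 / 60) ^+ 2 * s ^+ 3.
    by rewrite /v; field.
  rewrite e3 /v in e1 *; lra.
lra.
Qed.

(** The fraction [6 / 17] lies just below [1 / sqrt 8], and [k + 1] allows for rounding down. The
    geometric sum costs a factor of order [E = exp (s ^ 2 / 2)]. *)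
Lemma tail_sum_le (k : nat) : 6 / 17 * s <= (k%:R + 1) * (p * r) ->
  \sum_(l <- index_iota k.+1 N.+1) Ebin R (z l) p (fun j => (b <= j%:R)%R%:R) <=
  2 * expR (2 - s ^+ 2 / 60).
Proof.
have s1 := s_big; have r0 := r_gt0; have p0 := p_gt0.
move=> ks; set h := 199 / 200 * (p * r) * v.
have v0 : 0 < v by rewrite /v; lra.
have vE : v <= E by rewrite /v; apply: le_trans E_ge; nra.
have pr0 : 0 < p * r by rewrite mulr_gt0.
have h0 : 0 < h by rewrite /h; apply: mulr_gt0 v0; apply: mulr_gt0 pr0; lra.
have prv : p * r * v <= 1 by rewrite -prE ler_wpM2l// ltW.
have h1 : h <= 1 by rewrite /h; lra.
set C := expR (v ^+ 2 / 2 - 2 / 3 * s * v + 1).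
apply: (@le_trans _ _ (\sum_(l <- index_iota k.+1 N.+1) C * expR (- h) ^+ l.-1)).
  rewrite big_seq [leRHS]big_seq; apply: ler_sum => l.
  rewrite mem_index_iota ltnS => /andP[kl lN]; apply: tail_one_le.
  by rewrite lN (leq_ltn_trans _ kl).
rewrite -mulr_sumr big_add1 /=.
have h01 : 0 < h <= 1 by rewrite h0.
have geo := geometric_tail_le R h k N h01.
apply: le_trans (ler_wpM2l (expR_ge0 _) geo) _.
have hE : 2 / h <= 2 * E.
  rewrite ler_pdivrMr// -[leLHS]mulr1 -mulrA ler_wpM2l// -prE /h.
  rewrite mulrC ler_wpM2l ?(ltW E_gt0)//.
  have : 0 <= p * r * (199 / 200 * v - 1).
    by apply: mulr_ge0; [exact: ltW | rewrite /v; lra].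
  by lra.
rewrite mulrA; apply: (@le_trans _ _ (C * expR (- h) ^+ k * (2 * E))).
  by rewrite ler_wpM2l// mulr_ge0 ?exprn_ge0 ?expR_ge0.
rewrite -expRM_natr mulrCA ler_wpM2l// /C /E -!expRD ler_expR.
(* Here [199 / 200 * 6 / 17 > 35 / 100], and replacing [k + 1] by [k] costs [h <= 1]. With
   [2 / 3 + 35 / 100 = 61 / 60] the exponent becomes [2 + (s ^ 2 - v ^ 2) / 2], and
   [(61 / 60) ^ 2 - 1 > 1 / 30]. *)
have hk : 35 / 100 * s * v - 1 <= h * k%:R.
  have e1 : 6 / 17 * s * v <= (k%:R + 1) * (p * r) * v.
    by rewrite ler_wpM2r// ltW.
  have e2 : 0 <= s * v by rewrite mulr_ge0 ?ltW//; lra.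
  rewrite /h; nra.
rewrite /v in hk *; nra.
Qed.

(** The largest value of [2 a + 2] for [a <= s / 3 + 5]; it bounds, in units of [r], the distance
    from the mean to the window centre [(r + a) ^ 2]. *)
Let A : R := 2 / 3 * s + 12.

(** Tilting the mean from [M] to [w ^ 2] takes [u] at most about [A / r]. The further terms [2 w]
    and [p (w ^ 2 + 2 w)] stay below [4 r], which explains [A + 4]. *)
Lemma window_one_ge (l : nat) (a : R) : (1 <= l <= N)%N -> l%:R <= E ->
  2 <= a <= s / 3 + 5 ->
  3 / 4 * expR (- (101 / 100 * A * (A + 4))) <=
  Ebin R (z l) p (fun j => (`|j%:R - (r + a) ^+ 2| <= 2 * (r + a))%R%:R).
Proof.
have s1 := s_big; have r0 := r_gt0; have p0 := p_gt0.
have rs := r_ges; have prle := pr1; have p1 := p_le.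
move=> lN lE /andP[a2 aS].
have /andP[M1 M2] := mean_bounds l lN lE.
set M := (z l)%:R * p in M1 M2.
have rr : 400 * r <= r ^+ 2 by rewrite expr2 ler_wpM2r ?(ltW r0)//; lra.
have M3 : r ^+ 2 <= 101 / 100 * M by lra.
have M0 : 0 < M by have := sqr_ge0 r; lra.
have aa : a ^+ 2 + 1 <= r.
  apply: le_trans r_ge.
  have : a ^+ 2 <= s ^+ 2 by rewrite !expr2; apply: ler_pM; lra.
  have : s ^+ 2 * 400 <= s ^+ 3 by rewrite [leRHS]exprSr ler_wpM2l ?sqr_ge0.
  by have := sqr_ge0 s; nra.
set w := r + a.
have w0 : 0 < w by rewrite /w; lra.
have A2 : 2 * a + 2 <= A by rewrite /A; lra.
have ww : w ^+ 2 = r ^+ 2 + 2 * a * r + a ^+ 2 by rewrite /w; ring.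
have D1 : w ^+ 2 - M <= A * r.
  apply: (@le_trans _ _ ((2 * a + 2) * r)); last by rewrite ler_wpM2r ?(ltW r0).
  by rewrite ww; lra.
have ar : 2 * r <= a * r by rewrite ler_wpM2r ?(ltW r0).
have D0 : 0 <= w ^+ 2 - M by rewrite ww; have := sqr_ge0 a; lra.
set u := (w ^+ 2 - M) / M.
have u0 : 0 <= u by apply: divr_ge0 => //; exact: ltW.
have uM : M * (1 + u) = w ^+ 2 by rewrite /u; field; rewrite gt_eqF.
have ur : u * r <= 101 / 100 * A.
  rewrite /u mulrAC ler_pdivrMr//.
  apply: (@le_trans _ _ (A * (r ^+ 2))).
    by rewrite expr2 mulrA ler_wpM2r ?(ltW r0).
  by rewrite [_ * A]mulrC -mulrA ler_wpM2l//; rewrite /A; lra.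
have w11 : w ^+ 2 <= 11 / 10 * r ^+ 2.
  have : 2 * a * r <= 5 / 100 * r ^+ 2.
    by rewrite expr2 mulrA ler_wpM2r ?(ltW r0)//; lra.
  by rewrite ww; lra.
have pw : p * (w ^+ 2 + 2 * w) <= 12 / 10 * r.
  apply: (@le_trans _ _ (p * (12 / 10 * r ^+ 2))).
    have wr : w <= 2 * r by rewrite /w; lra.
    by rewrite ler_wpM2l ?(ltW p0)//; lra.
  rewrite (_ : p * _ = 12 / 10 * r * (p * r)); last by ring.
  by rewrite ler_piMr//; lra.
have pu1 : p * (1 + u) <= 1.
  have : M * (p * (1 + u)) <= M * 1.
    rewrite mulr1 mulrCA uM; apply: (@le_trans _ _ (1 / 100 * w ^+ 2)).
      by rewrite ler_wpM2r ?sqr_ge0//; lra.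
    lra.
  by rewrite ler_pM2l.
have p01 : 0 < p <= 1 by rewrite p0; lra.
apply: le_trans (Ebin_window (z l) p u w p01 u0 w0 _ pu1); last first.
  by rewrite mulrA.
rewrite ler_wpM2l// ler_expR lerN2 -/M.
apply: (@le_trans _ _ (u * (r * (A + 4)))).
  have wr : w <= 21 / 20 * r by rewrite /w; lra.
  by rewrite ler_wpM2l//; lra.
by rewrite mulrA ler_wpM2r// /A; lra.
Qed.

End estimates.

(** * The quantitative bound for fixed [n] *)

(** The first error term bounds the late exceedances of [b]; the second bounds the chance that one
    of the windows is missed by the first [m] variables. *)
Lemma max1_max2_truncate_bound (R : realType) (n p r s : R) (N k : nat)
    (z : nat -> nat) d (T : measurableType d) (P : probability T R)
    (X : nat -> {RV P >-> nat}) :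
  400 <= s -> 0 < p -> 0 < r -> n * p = r ^+ 2 ->
  p * r * expR (s ^+ 2 / 2) = 1 -> expR (s ^+ 2 / 2) ^+ 5 <= r ->
  N%:R * p <= 1 / 100 -> (k <= N)%N ->
  6 / 17 * s <= (k%:R + 1) * (p * r) ->
  (forall l, (1 <= l <= N)%N ->
     n - (l%:R - 1) * (n * p) + 2^-1 * (l%:R - 1) * (l%:R - 2) * (n * p ^+ 2) - 1
     <= (z l)%:R <=
     n - (l%:R - 1) * (n * p) + 2^-1 * (l%:R - 1) * (l%:R - 2) * (n * p ^+ 2) + 1) ->
  mutually_independent [set l | (1 <= l <= N)%N] X ->
  (forall l, (1 <= l <= N)%N -> forall A,
     distribution P (X l) A = binomial_prob (z l) p A) ->
  ((1 - 2 * expR (2 - s ^+ 2 / 60)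
      - 6 * expR (194 + 19 * s - s ^+ 2 / 20))%:E <=
   P [set w | max1 N (X ^~ w) = max1 k (X ^~ w) /\
              max2 N (X ^~ w) = max2 k (X ^~ w)])%E.
Proof.
move=> s1 p0 r0 npE prE Er Np kN ks zP indep distX.
set E := expR (s ^+ 2 / 2) in prE Er.
have E_ge : s ^+ 2 / 2 + 1 <= E by rewrite addrC expR_ge1Dx.
have E0 : 0 < E by exact: expR_gt0.
have E2 : 2 <= E by apply: le_trans E_ge; nra.
have E1 : 1 <= E by lra.
have rE : E <= r by apply: le_trans Er; rewrite ler_eXnr.
have pE : p * E <= 1.
  rewrite -prE mulrAC ler_peMr ?(le_trans E1)//.
  by rewrite mulr_ge0// ltW.
have p01 : 0 <= p <= 1.
  by rewrite ltW//=; apply: le_trans pE; rewrite ler_peMr// ltW.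
pose m := Num.truncn E.
have /andP[mE Em] := truncn_itv (ltW E0).
have {}Em : E < m%:R + 1 by rewrite natr1.
have mk : (m <= k)%N.
  rewrite -(ler_nat R).
  have : 6 / 17 * s * E <= k%:R + 1.
    have := ler_wpM2r (ltW E0) ks.
    by rewrite -[leRHS]mulrA prE mulr1.
  have : 2 * E <= 6 / 17 * s * E by rewrite ler_wpM2r// ?ltW//; lra.
  by rewrite /m in mE Em *; lra.
have XP l A : (1 <= l <= N)%N -> P (X l @^-1` A) =
    (Ebin R (z l) p (fun j => (j \in A)%:R))%:E.
  by move=> lN; rewrite -binomial_prob_Ebin// -distX.
pose b := r ^+ 2 + 2 / 3 * s * r.
pose W (w : R) : set nat := [set j | `|j%:R - w ^+ 2| <= 2 * w].
(* The windows are [[w ^ 2 - 2 w, w ^ 2 + 2 w]]. They are disjoint because [w2 - w1 = 3 > 2], and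
   the offset 2 puts the lower end of the first one above [b]. *)
pose w1 := r + (s / 3 + 2); pose w2 := r + (s / 3 + 5).
pose q := 3 / 4 * expR (- (101 / 100 * (2 / 3 * s + 12) * (2 / 3 * s + 12 + 4))).
have WP (a : R) : 2 <= a <= s / 3 + 5 -> forall l, (1 <= l <= m)%N ->
    (q%:E <= P (X l @^-1` (W (r + a)%R)))%E.
  move=> aS l /andP[l1 lm].
  have lN : (1 <= l <= N)%N by rewrite l1 (leq_trans lm)// (leq_trans mk).
  have lE : l%:R <= E by apply: le_trans mE; rewrite ler_nat.
  rewrite XP// lee_fin.
  apply: le_trans (window_one_ge n p r s N z s1 p0 r0 npE prE Er Np zP l a lN lE aS) _.
  apply: ler_Ebin => // j _; rewrite ler_nat.
  by case: (boolP (j \in _)) => // /negP jW; case: (boolP (_ <= _)%R) => // jW';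
    case: jW; rewrite inE.
have := @max1_max2_truncate_prob R d T P X N k m (W w1) (W w2)
  [set j | b <= j%:R] q (2 * expR (2 - s ^+ 2 / 60)) indep.
rewrite mk kN => /(_ isT) main; apply: le_trans (main _ _ _ _ _).
- rewrite lee_fin lerD2l lerN2.
  have q0 : 0 < q by apply: mulr_gt0; [lra | exact: expR_gt0].
  have mq : E / 2 * q <= m%:R * q.
    by rewrite ler_wpM2r ?(ltW q0)//; lra.
  have mq0 : 0 < E / 2 * q by apply: mulr_gt0 q0; lra.
  (* The crude [exp (- y) <= 1 / y] suffices, since [E q] itself is exponentially large in [s ^ 2]:
     [101 / 100 * 4 / 9 < 1 / 2 - 1 / 20]. *)
  apply: (@le_trans _ _ (2 * (E / 2 * q)^-1)).
    rewrite ler_wpM2l// expRN lef_pV2 ?posrE ?expR_gt0//.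
    apply: le_trans (expR_ge1Dx _); lra.
  have -> : 2 * (E / 2 * q)^-1 = 16 / 3 *
     expR (101 / 100 * (2 / 3 * s + 12) * (2 / 3 * s + 12 + 4) - s ^+ 2 / 2).
    rewrite expRB -/E /q expRN; field.
    by rewrite !gt_eqF ?expR_gt0.
  apply: ler_pM; [lra | exact: expR_ge0 | lra |].
  by rewrite ler_expR; nra.
- move=> i j; rewrite /W /= !ler_norml => /andP[_ iw] /andP[jw _].
  by rewrite -(ltr_nat R); rewrite /w1 /w2 in iw jw; nra.
- move=> i j; rewrite /W /= !ler_norml => /andP[iw _] /negP; rewrite -ltNge => jb.
  by rewrite -(ltr_nat R); rewrite /w1 /b in iw jb; nra.
- by apply: WP; lra.
- by apply: WP; lra.
- apply: le_trans (_ : (\sum_(l <- index_iota k.+1 N.+1)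
     (Ebin R (z l) p (fun j => (b <= j%:R)%R%:R))%:E)%E <= _)%E; last first.
    rewrite sumEFin lee_fin.
    exact: tail_sum_le n p r s N z s1 p0 r0 npE prE Er Np zP k ks.
  rewrite big_seq [leRHS]big_seq; apply: lee_sum => l.
  rewrite mem_index_iota ltnS => /andP[kl lN].
  rewrite XP; last by rewrite lN (leq_ltn_trans _ kl).
  rewrite lee_fin; apply: ler_Ebin => // j _; rewrite ler_nat.
  by case: (boolP (j \in _)) => //; rewrite inE /= => ->.
Qed.

(** * The regime of the parameters *)

Lemma rounding_close (R : realType) (x : R) (m : nat) :
  rounding x m -> x - 1 <= m%:R <= x + 1.
Proof.
have mE : m%:R = (m%:Z)%:~R :> R by [].
case=> mx; rewrite mE mx.
- by have := floor_le x; have := floorD1_gt x; rewrite intrD; lra.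
- by have := ceil_ge x; have := gt_pred_ceil x; rewrite intrB; lra.
Qed.

Section regime.
Context {R : realType} (n p c : R).
Hypothesis c_ge : 400 <= c.
Hypothesis n1 : 1 <= n.
Hypothesis p0 : 0 < p.
Hypothesis np_lower : n ^+ 5 <= (n * p) ^+ 8.
Hypothesis np3_small : n * p ^+ 3 <= expR (- c ^+ 2).

Let s : R := Num.sqrt (ln (1 / (n * p ^+ 3))).
Let r : R := Num.sqrt (n * p).
Let n0 : 0 < n. Proof. exact: lt_le_trans n1. Qed.
Let np0 : 0 < n * p. Proof. exact: mulr_gt0. Qed.
Let D0 : 0 < n * p ^+ 3. Proof. by rewrite mulr_gt0// exprn_gt0. Qed.

Lemma sqrt_ln_ge (A : R) : 0 <= A -> n * p ^+ 3 <= expR (- A ^+ 2) ->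
  A <= s /\ s ^+ 2 = ln (1 / (n * p ^+ 3)).
Proof.
move=> A0 DA.
have AL : A ^+ 2 <= ln (1 / (n * p ^+ 3)).
  rewrite div1r lnV ?posrE// lerNr -[leRHS]expRK ler_ln ?posrE//.
  exact: expR_gt0.
have L0 : 0 <= ln (1 / (n * p ^+ 3)) by apply: le_trans AL; exact: sqr_ge0.
split; last by rewrite sqr_sqrtr.
by rewrite -(ger0_norm A0) -sqrtr_sqr ler_wsqrtr.
Qed.

Let c_ge0 : 0 <= c. Proof. by have := c_ge; lra. Qed.

Lemma sqrt_ln_ge400 : 400 <= s.
Proof. by have [cs _] := sqrt_ln_ge c c_ge0 np3_small; apply: le_trans cs. Qed.

Let s2 : s ^+ 2 = ln (1 / (n * p ^+ 3)).
Proof. by have [] := sqrt_ln_ge c c_ge0 np3_small. Qed.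

Lemma sqrt_np_gt0 : 0 < r. Proof. by rewrite sqrtr_gt0. Qed.

Lemma sqr_sqrt_np : n * p = r ^+ 2. Proof. by rewrite sqr_sqrtr// ltW. Qed.

Let expR_sqr : expR (s ^+ 2 / 2) ^+ 2 = 1 / (n * p ^+ 3).
Proof.
rewrite -expRM_natr mulfVK// s2 lnK// posrE.
by rewrite divr_gt0.
Qed.

Lemma p_sqrt_np_expR : p * r * expR (s ^+ 2 / 2) = 1.
Proof.
have x0 : 0 <= p * r * expR (s ^+ 2 / 2).
  by rewrite mulr_ge0 ?expR_ge0// mulr_ge0 ?(ltW p0) ?(ltW sqrt_np_gt0).
apply/eqP; rewrite -(@eqrXn2 _ 2)// expr1n !exprMn expR_sqr -sqr_sqrt_np.
by apply/eqP; field; rewrite !gt_eqF.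
Qed.

Lemma np_ge1 : 1 <= n * p.
Proof.
rewrite -(@ler_pXn2r _ 8) ?nnegrE ?(ltW np0)// expr1n.
by apply: le_trans np_lower; rewrite exprn_ege1.
Qed.

(** The exponent 5 comes from [n ^ (5 / 8) <= n p]: the square of [np_lower] says exactly
    [1 <= n p (n p ^ 3) ^ 5], where [n p ^ 3 = E ^ (-2)] for [E = exp (s ^ 2 / 2)]. *)
Lemma expR_le_sqrt_np : expR (s ^+ 2 / 2) ^+ 5 <= r.
Proof.
rewrite -(@ler_pXn2r _ 2) ?nnegrE ?exprn_ge0 ?expR_ge0 ?(ltW sqrt_np_gt0)//.
rewrite -sqr_sqrt_np exprAC expR_sqr div1r exprVn -[X in X <= _]div1r.
rewrite ler_pdivrMr ?exprn_gt0//.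
have : (n ^+ 5) ^+ 2 <= ((n * p) ^+ 8) ^+ 2.
  by rewrite lerXn2r// nnegrE exprn_ge0// ltW.
rewrite (_ : ((n * p) ^+ 8) ^+ 2 =
   (n ^+ 5) ^+ 2 * (n * p * (n * p ^+ 3) ^+ 5)); last by ring.
by rewrite -{1}[(n ^+ 5) ^+ 2]mulr1 ler_pM2l// exprn_gt0// exprn_gt0.
Qed.

Lemma p_le_400V : p <= 1 / 400.
Proof.
have E1 : s ^+ 2 / 2 + 1 <= expR (s ^+ 2 / 2) by rewrite addrC expR_ge1Dx.
have E2 : 400 <= expR (s ^+ 2 / 2).
  by apply: le_trans E1; have := sqrt_ln_ge400; nra.
have r1 : 1 <= r.
  by rewrite -[X in X <= _]sqrtr1 ler_wsqrtr// np_ge1.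
have pr : p <= p * r by rewrite ler_peMr ?(ltW p0).
have : p * 400 <= p * r * expR (s ^+ 2 / 2).
  by apply: ler_pM; [exact: ltW | exact: ler0n | |].
by rewrite p_sqrt_np_expR; lra.
Qed.

(** Equivalent to [n <= (n p) ^ 3], which holds since [n ^ 5 <= (n p) ^ 8 <= (n p) ^ 15]. *)
Lemma ln_np3_le_ln : s ^+ 2 <= ln n.
Proof.
rewrite s2 ler_ln ?posrE ?divr_gt0// ler_pdivrMr//.
have -> : n * (n * p ^+ 3) = (n * p) ^+ 3 / n by field; rewrite gt_eqF.
rewrite ler_pdivlMr// mul1r.
rewrite -(@ler_pXn2r _ 5) ?nnegrE ?exprn_ge0 ?(ltW n0) ?(ltW np0)//.
by apply: le_trans np_lower _; rewrite -exprM ler_weXn2l// np_ge1.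
Qed.

Let kr : R := 2^-1 * Num.sqrt (ln (1 / (n * p ^+ 3)) / (2 * n * p ^+ 3)).
Let x : R := 15 * p ^- 2 * Num.sqrt (n^-1 * ln n).

Let kr_sqr : (kr * (p * r)) ^+ 2 = s ^+ 2 / 8.
Proof.
rewrite /kr !exprMn sqr_sqrtr; last first.
  by rewrite -s2 divr_ge0 ?sqr_ge0// -mulrA mulr_ge0// ltW.
by rewrite -s2 -sqr_sqrt_np; field; rewrite !gt_eqF.
Qed.

Let kr_ge0 : 0 <= kr. Proof. by rewrite mulr_ge0 ?invr_ge0 ?sqrtr_ge0. Qed.

Let pr_gt0 : 0 < p * r. Proof. exact: mulr_gt0 sqrt_np_gt0. Qed.

Lemma kstar_real_ge : 6 / 17 * s <= kr * (p * r).
Proof.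
have s1 := sqrt_ln_ge400.
have s0 : 0 <= 6 / 17 * s by lra.
have k0 : 0 <= kr * (p * r) by rewrite mulr_ge0// ltW.
rewrite -(@ler_pXn2r _ 2) ?nnegrE//.
by rewrite kr_sqr exprMn; have := sqr_ge0 s; lra.
Qed.

(** After multiplication by [p r] and squaring, the two sides are [s ^ 2 / 8] and [225 ln n / p]. *)
Lemma kstar_real_le : kr <= x.
Proof.
have x0 : 0 <= x by rewrite mulr_ge0 ?sqrtr_ge0// mulr_ge0 ?invr_ge0 ?sqr_ge0.
rewrite -(ler_pM2r pr_gt0).
have k0 : 0 <= kr * (p * r) by rewrite mulr_ge0// ltW.
have y0 : 0 <= x * (p * r) by rewrite mulr_ge0// ltW.
rewrite -(@ler_pXn2r _ 2) ?nnegrE//.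
have lnn : s ^+ 2 <= ln n := ln_np3_le_ln.
have ln0 : 0 <= ln n by apply: ln_ge0.
rewrite kr_sqr /x !exprMn [Num.sqrt (n^-1 * _) ^+ 2]sqr_sqrtr; last first.
  by rewrite mulr_ge0 ?invr_ge0// ltW.
rewrite -sqr_sqrt_np.
have -> : 15 ^+ 2 * p ^- 2 ^+ 2 * (n^-1 * ln n) * (p ^+ 2 * (n * p)) =
  15 ^+ 2 * (ln n / p) by field; rewrite !gt_eqF.
have : ln n <= ln n / p.
  by rewrite ler_pdivlMr// ler_piMr//; have := p_le_400V; lra.
have := sqr_ge0 s; lra.
Qed.

Lemma k_real_gt0 : 0 < x.
Proof.
apply: lt_le_trans kstar_real_le.
have := kstar_real_ge; have := sqrt_ln_ge400 => s1 h.
by rewrite -(ltr_pM2r pr_gt0) mul0r; lra.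
Qed.

(** Makes [k p] small, as the mean estimates require. The eighth power clears the roots and matches
    [np_lower]. *)
Lemma k_real_p_le (e : R) : 0 <= e -> ln n ^+ 4 <= e ^+ 8 * n -> x * p <= 15 * e.
Proof.
move=> e0 lnn.
have a0 : 0 <= n^-1 * ln n by rewrite mulr_ge0 ?invr_ge0 ?(ltW n0) ?ln_ge0.
set y := Num.sqrt (n^-1 * ln n) / p.
have -> : x * p = 15 * y by rewrite /x /y; field; rewrite gt_eqF.
rewrite ler_wpM2l ?ler0n//.
have y0 : 0 <= y by rewrite divr_ge0 ?sqrtr_ge0// ltW.
rewrite -(@ler_pXn2r _ 8) ?nnegrE//.
have -> : y ^+ 8 = ln n ^+ 4 * (n ^+ 4 / (n * p) ^+ 8).
  rewrite exprMn (exprM (Num.sqrt _) 2 4) [Num.sqrt _ ^+ 2]sqr_sqrtr//.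
  by field; rewrite !gt_eqF.
apply: le_trans (ler_wpM2r _ lnn) _.
  by rewrite divr_ge0// exprn_ge0// ltW.
rewrite mulrA ler_pdivrMr ?exprn_gt0// -mulrA -exprS.
by rewrite ler_wpM2l// exprn_ge0.
Qed.

End regime.

(** * Asymptotics as [n] tends to infinity *)

(** With [y = ln n], one has [n = exp (y / 5) ^ 5 >= (y / 5) ^ 5], which beats [y ^ 4 / e] once
    [y >= 5 ^ 5 / e]. *)
Lemma ln_pow4_small (R : realType) (e : R) : 0 < e ->
  \forall n \near \oo, ln (n%:R : R) ^+ 4 <= e * n%:R.
Proof.
move=> e0; near=> n.
have n0 : 0 < n%:R :> R by rewrite ltr0n; near: n; exact: nbhs_infty_gt.
set y := ln n%:R.
have ye : 5 ^+ 5 / e <= y.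
  rewrite -[leLHS]expRK ler_ln ?posrE ?expR_gt0//.
  by near: n; exact: nbhs_infty_ger.
have y0 : 0 <= y by apply: le_trans ye; rewrite divr_ge0 ?exprn_ge0// ltW.
have -> : n%:R = expR (5%:R * (y / 5)) by rewrite mulrC divfK// lnK ?posrE.
rewrite expRM_natl.
apply: (@le_trans _ _ (e * (y / 5) ^+ 5)); last first.
  rewrite ler_wpM2l ?(ltW e0)// lerXn2r ?nnegrE ?expR_ge0 ?divr_ge0//.
  by apply: le_trans (expR_ge1Dx _); rewrite lerDr.
rewrite expr_div_n [y ^+ 5]exprS mulrA mulrCA -[leLHS]mul1r.
have : 5 ^+ 5 <= e * y by move: ye; rewrite ler_pdivrMr// mulrC.
move=> h; have y4 : 0 <= y ^+ 4 by exact: exprn_ge0.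
rewrite (_ : _ * _ / _ = (e * y / 5 ^+ 5) * y ^+ 4); last by field.
by rewrite ler_wpM2r// ler_pdivlMr ?exprn_gt0// mul1r.
Unshelve. all: by end_near. Qed.

Lemma cvg_expRN (R : realType) (h : nat -> R) :
  (forall A, \forall n \near \oo, A <= h n) -> expR (- h n) @[n --> \oo] --> (0 : R).
Proof.
move=> hy; have hc : h n @[n --> \oo] --> +oo by apply/cvgryPge.
exact: (cvg_comp _ _ hc (@cvgr_expR R)).
Qed.

Lemma np_lower_near (R : realType) (eps : R) (p : nat -> R) : 0 < eps ->
  (\forall n \near \oo, n%:R `^ (5 / 8 + eps) <= n%:R * p n) ->
  \forall n \near \oo, 0 < p n /\ n%:R ^+ 5 <= (n%:R * p n) ^+ 8.
Proof.
move=> e0 H; near=> n.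
have n0 : (0 < n)%N by near: n; exact: nbhs_infty_gt.
have n1 : 1 <= n%:R :> R by rewrite ler1n.
have n0R : 0 < n%:R :> R by rewrite ltr0n.
have le_np : n%:R `^ (5 / 8) <= n%:R * p n.
  apply: (@le_trans _ _ (n%:R `^ (5 / 8 + eps))); last by near: n.
  by rewrite ler_powR// lerDl ltW.
have pw0 : 0 < n%:R `^ (5 / 8) :> R by rewrite powR_gt0.
split.
  by rewrite -(pmulr_rgt0 _ n0R) (lt_le_trans pw0).
have -> : n%:R ^+ 5 = (n%:R `^ (5 / 8)) ^+ 8 :> R.
  by rewrite -!powR_mulrn ?powR_ge0// -powRrM; congr (_ `^ _); field.
by rewrite lerXn2r ?nnegrE ?powR_ge0// (le_trans _ le_np)// powR_ge0.
Unshelve. all: by end_near. Qed.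

(** The little-o bound with constant [exp (- A ^ 2 / 3)], cubed and divided by [n ^ 2]. *)
Lemma np3_small_near (R : realType) (p : nat -> R) (A : R) :
  (fun n => n%:R * p n : R^o) =o_\oo (fun n => n%:R `^ (2 / 3) : R^o) ->
  \forall n \near \oo, n%:R * p n ^+ 3 <= expR (- A ^+ 2).
Proof.
move=> /eqoP /(_ (expR (- A ^+ 2 / 3)) (expR_gt0 _)) H; near=> n.
have n0 : (0 < n)%N by near: n; exact: nbhs_infty_gt.
have n0R : 0 < n%:R :> R by rewrite ltr0n.
have : `|n%:R * p n| <= expR (- A ^+ 2 / 3) * `|n%:R `^ (2 / 3)|.
  by near: n; exact: H.
rewrite (ger0_norm (powR_ge0 _ _)) => np.
have : `|n%:R * p n| ^+ 3 <= (expR (- A ^+ 2 / 3) * n%:R `^ (2 / 3)) ^+ 3.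
  by rewrite lerXn2r ?nnegrE ?mulr_ge0 ?expR_ge0 ?powR_ge0.
rewrite exprMn -expRM_natr divfK// -[(_ `^ _) ^+ 3]powR_mulrn ?powR_ge0// -powRrM.
rewrite divfK// powR_mulrn ?ler0n// => h.
have : (n%:R * p n) ^+ 3 <= expR (- A ^+ 2) * n%:R ^+ 2.
  by apply: le_trans h; rewrite -normrX ler_norm.
rewrite (_ : (n%:R * p n) ^+ 3 = n%:R * p n ^+ 3 * n%:R ^+ 2); last by ring.
by rewrite ler_pM2r// exprn_gt0.
Unshelve. all: by end_near. Qed.

Theorem corollary3p26 (R : realType) (eps : R) (p : nat -> R)
  (kstar : nat -> nat) (z : nat -> nat -> nat)
  (d : nat -> measure_display) (T : forall n, measurableType (d n))
  (P : forall n, probability (T n) R)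
  (Z : forall n, nat -> {RV (P n) >-> nat}) :
  0 < eps < 24^-1 ->
  (\forall n \near \oo, n%:R `^ (5 / 8 + eps) <= n%:R * p n) ->
  (fun n => n%:R * p n : R^o) =o_\oo (fun n => n%:R `^ (2 / 3) : R^o) ->
  (\forall n \near \oo, rounding (kstar_real p n) (kstar n)) ->
  (\forall n \near \oo, forall l, (1 <= l <= 2 * k_ p n)%N ->
     rounding (z_real p n l) (z n l)) ->
  (\forall n \near \oo,
     mutually_independent [set l | (1 <= l <= 2 * k_ p n)%N] (Z n)) ->
  (\forall n \near \oo, forall l, (1 <= l <= 2 * k_ p n)%N ->
     forall A : set nat, distribution (P n) (Z n l) A = binomial_prob (z n l) (p n) A) ->
  aas P (fun n => [set w |
    max1 (2 * k_ p n) (fun l => Z n l w) = max1 (kstar n) (fun l => Z n l w) /\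
    max2 (2 * k_ p n) (fun l => Z n l w) = max2 (kstar n) (fun l => Z n l w)]).
Proof.
move=> /andP[eps0 _] np_ge np_le kstarP zP indep distZ.
pose s n : R := Num.sqrt (ln (1 / (n%:R * p n ^+ 3))).
have lower := np_lower_near R eps p eps0 np_ge.
have p_near : \forall n \near \oo, 0 < p n by apply: filterS lower => n [].
have s_infty A : \forall n \near \oo, A <= s n.
  near=> n; apply: (@le_trans _ _ `|A|); first exact: ler_norm.
  have n0 : (0 < n)%N by near: n; exact: nbhs_infty_gt.
  have [] // := @sqrt_ln_ge R n%:R (p n) _ _ `|A|.
  - by rewrite ler1n.
  - by near: n.
  - by near: n; exact: np3_small_near.
(* Chosen so that [2 x p <= 30 e = 1 / 200]; with [2 p <= 1 / 200] this gives [2 k p <= 1 / 100]. *)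
pose e : R := 200^-1 / 30.
have e0 : 0 < e by rewrite /e; lra.
have e30 : 30 * e = 1 / 200 by rewrite /e; field.
move: e e0 e30 => e e0 e30.
have main : \forall n \near \oo,
  ((1 - 2 * expR (- (s n ^+ 2 / 60 - 2))
      - 6 * expR (- (s n ^+ 2 / 20 - 194 - 19 * s n)))%:E <=
   P n [set w |
    max1 (2 * k_ p n) (fun l => Z n l w) = max1 (kstar n) (fun l => Z n l w) /\
    max2 (2 * k_ p n) (fun l => Z n l w) = max2 (kstar n) (fun l => Z n l w)])%E.
  near=> n.
  have n0 : (0 < n)%N by near: n; exact: nbhs_infty_gt.
  have n1 : 1 <= n%:R :> R by rewrite ler1n.
  have [p0 np8] : 0 < p n /\ n%:R ^+ 5 <= (n%:R * p n) ^+ 8 by near: n.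
  pose c : R := 400; have c400 : 400 <= c by [].
  have np3 : n%:R * p n ^+ 3 <= expR (- c ^+ 2).
    by near: n; exact: np3_small_near.
  have ln4 : ln n%:R ^+ 4 <= e ^+ 8 * n%:R.
    by near: n; apply: ln_pow4_small; exact: exprn_gt0.
  move: c c400 np3 => c c400 np3.
  have /rounding_close/andP[ks1 ks2] : rounding (kstar_real p n) (kstar n) by near: n.
  pose x : R := 15 * p n ^- 2 * Num.sqrt (n%:R^-1 * ln n%:R).
  have x0 : 0 < x by exact: k_real_gt0 n%:R (p n) c c400 n1 p0 np8 np3.
  have xp : x * p n <= 15 * e.
    exact: k_real_p_le n%:R (p n) n1 p0 np8 e (ltW e0) ln4.
  have krx : kstar_real p n <= x.
    exact: kstar_real_le n%:R (p n) c c400 n1 p0 np8 np3.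
  have kE : (k_ p n)%:R = (Num.ceil x)%:~R :> R.
    by rewrite /k_ natr_absz ger0_norm// ceil_ge0 (lt_trans _ x0).
  have kx1 : x <= (k_ p n)%:R by rewrite kE ceil_ge.
  have kx2 : (k_ p n)%:R < x + 1.
    by rewrite kE -ltrBlDr; have := gt_pred_ceil x; rewrite intrB.
  have k1 : (1 <= k_ p n)%N.
    by rewrite -(ltr_nat R); exact: lt_le_trans kx1.
  apply: le_trans (max1_max2_truncate_bound R n%:R (p n) (Num.sqrt (n%:R * p n))
    (s n) (2 * k_ p n) (kstar n) (z n) _ (T n) (P n) (Z n) _ _ _ _ _ _ _ _ _ _ _ _).
  - by rewrite lee_fin le_eqVlt; apply/orP; left; apply/eqP;
      congr (_ - _ * expR _ - _ * expR _); ring.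
  - exact: sqrt_ln_ge400 n%:R (p n) c c400 n1 p0 np3.
  - exact: p0.
  - exact: sqrt_np_gt0 n%:R (p n) n1 p0.
  - exact: sqr_sqrt_np n%:R (p n) n1 p0.
  - exact: p_sqrt_np_expR n%:R (p n) c c400 n1 p0 np3.
  - exact: expR_le_sqrt_np n%:R (p n) c c400 n1 p0 np8 np3.
  - have psm : p n <= 1 / 400 by exact: p_le_400V n%:R (p n) c c400 n1 p0 np8 np3.
    rewrite natrM; apply: (@le_trans _ _ (2 * (x + 1) * p n)).
      by rewrite ler_wpM2r ?(ltW p0)// ler_wpM2l// ltW.
    by lra.
  (* Rounding up may exceed the real value by 1, so [kstar n <= k + 1 < 2 k + 1], using [k >= 1]. *)
  - have : (kstar n)%:R < (2 * k_ p n)%:R + 1 :> R.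
      rewrite natrM; have : 1 <= (k_ p n)%:R :> R by rewrite ler1n.
      by lra.
    by rewrite natr1 ltr_nat ltnS.
  - have kr : 6 / 17 * s n <= kstar_real p n * (p n * Num.sqrt (n%:R * p n)).
      exact: kstar_real_ge n%:R (p n) c c400 n1 p0 np3.
    apply: le_trans kr _; rewrite ler_wpM2r ?mulr_ge0 ?sqrtr_ge0 ?(ltW p0)//.
    by lra.
  - move=> l lN; apply: rounding_close.
    have : forall l, (1 <= l <= 2 * k_ p n)%N -> rounding (z_real p n l) (z n l).
      by near: n.
    exact.
  - by near: n.
  - by near: n.
have z1 : expR (- (s n ^+ 2 / 60 - 2)) @[n --> \oo] --> (0 : R).
  apply: cvg_expRN => A; near=> n.
  have h1 : 60 <= s n by near: n.
  have h2 : `|A| + 2 <= s n by near: n.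
  by have := ler_norm A; nra.
have z2 : expR (- (s n ^+ 2 / 20 - 194 - 19 * s n)) @[n --> \oo] --> (0 : R).
  apply: cvg_expRN => A; near=> n.
  (* For [s >= 400] the difference [s ^ 2 / 20 - 19 s] is at least [s]. *)
  have h1 : 400 <= s n by near: n.
  have h2 : `|A| + 194 <= s n by near: n.
  by have := ler_norm A; nra.
rewrite /aas.
apply: (@squeeze_cvge _ _ _ _ (fun n => (1 - 2 * expR (- (s n ^+ 2 / 60 - 2))
      - 6 * expR (- (s n ^+ 2 / 20 - 194 - 19 * s n)))%:E) _ (fun=> 1%E)).
- near=> n; apply/andP; split; first by near: n.
  by apply: probability_le1; exact: measurable_max1_max2_eq.
- apply: cvg_EFin; first by near=> n.
  have := cvgB (cvgB (cvg_cst (1 : R)) (cvgM (cvg_cst (2 : R)) z1))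
    (cvgM (cvg_cst (6 : R)) z2).
  by rewrite !mulr0 !subr0; apply.
- exact: cvg_cst.
Unshelve. all: by end_near. Qed.
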